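(* Let $n\geq 1$. Then for every permutation $\sigma\in\mathfrak{S}_{n+1}$ we have $|R_{\bullet}(\sigma)|\leq 4$.
   Context: $\mathfrak{S}_{n+1}$ is the symmetric group on $[n+1]=\{1,\ldots,n+1\}$, with product given by composition of functions read from the right; it is generated by $s_i=(i\ \ i+1)$, $i\in[n]$. A reduced word of $\sigma$ is a word $i_1i_2\cdots i_l$ with letters in $[n]$ such that $\sigma=s_{i_1}s_{i_2}\cdots s_{i_l}$ with $l$ minimal. $R(\sigma)$ is the set of reduced words of $\sigma$. A commutation replaces two consecutive letters $ij$ of a word, with $|i-j|>1$, by $ji$. Two reduced words of $\sigma$ are equivalent if they differ by a sequence of commutations; the equivalence class of $\mathbf{a}\in R(\sigma)$ is its commutation class $[\mathbf{a}]$. $R_{\bullet}(\sigma)$ is the set of one-element commutation classes of $\sigma$, i.e. the set of $\mathbf{a}\in R(\sigma)$ with $[\mathbf{a}]=\{\mathbf{a}\}$ (equivalently, the reduced words of $\sigma$ in which any two consecutive letters differ by exactly $1$). *)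

(* Defs.v *)
From mathcomp Require Import all_boot all_fingroup ssrint.

Set Implicit Arguments.
Unset Strict Implicit.
Unset Printing Implicit Defensive.

Import IntDist.

(* The points 1, ..., n+1 and the letters 1, ..., n are numbered from 0: letter
   i : 'I_n denotes the transposition of the points i and i+1 of 'I_n.+1. *)
Definition simple_transp (n : nat) (i : 'I_n) : 'S_n.+1 :=
  tperm (widen_ord (leqnSn n) i) (lift ord0 i).

(* Products of permutations are compositions of functions read from the right,
   whereas (s * t)%g in MathComp applies s first: see word_permE. *)
Definition word_perm (n : nat) (w : seq 'I_n) : 'S_n.+1 :=
  foldr (fun i s => (s * simple_transp i)%g) 1%g w.

Lemma word_permE (n : nat) (w : seq 'I_n) (x : 'I_n.+1) :
  word_perm w x = foldr (fun i y => simple_transp i y) x w.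
Proof. by elim: w => [|i w IHw] /=; rewrite ?perm1 // permM IHw. Qed.

Lemma word_perm_cat (n : nat) (u v : seq 'I_n) :
  word_perm (u ++ v) = (word_perm v * word_perm u)%g.
Proof. by elim: u => [|i u IHu] /=; rewrite ?mulg1 // IHu mulgA. Qed.

Lemma word_perm_tperm (n : nat) (x y : 'I_n.+1) :
  x < y -> exists w : seq 'I_n, word_perm w = tperm x y.
Proof.
case: y => y; elim: y => [//|y IHy] lt_y /=; rewrite ltnS => le_xy.
have lt_yn : y < n by [].
pose i := Ordinal lt_yn.
have Ey : Ordinal lt_y = lift ord0 i by apply: val_inj.
move: le_xy; rewrite leq_eqVlt => /orP[/eqP Exy | lt_xy].
  exists [:: i]; rewrite /= mul1g /simple_transp Ey; congr tperm.
  exact: val_inj.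
have lt_y' : y < n.+1 by apply: ltnW.
have [w Ew] := IHy lt_y' lt_xy.
exists ([:: i] ++ w ++ [:: i]); rewrite !word_perm_cat Ew /= mul1g.
have -> : Ordinal lt_y' = widen_ord (leqnSn n) i by apply: val_inj.
rewrite -[X in (X * _ * _)%g]tpermV -mulgA -[LHS]/(_ ^ _)%g tpermJ tpermL Ey.
by rewrite tpermD // -val_eqE /= ?(gtn_eqF lt_xy) // gtn_eqF // ltnW.
Qed.

Lemma word_perm_surj (n : nat) (s : 'S_n.+1) :
  exists w : seq 'I_n, word_perm w = s.
Proof.
have [ts -> _] := prod_tpermP s; elim: ts => [|[x y] ts [w Ew]].
  by exists [::]; rewrite big_nil.
have [w' Ew'] : exists w' : seq 'I_n, word_perm w' = tperm x y.
  have [lt_xy|lt_yx|/val_inj <-] := ltngtP x y; first exact: word_perm_tperm.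
    by rewrite tpermC; apply: word_perm_tperm.
  by exists [::]; rewrite tperm1.
by exists (w ++ w'); rewrite word_perm_cat Ew Ew' big_cons.
Qed.

Lemma perm_length_subproof (n : nat) (s : 'S_n.+1) :
  exists l, [exists w : l.-tuple 'I_n, word_perm w == s].
Proof.
have [w Ew] := word_perm_surj s.
by exists (size w); apply/existsP; exists (in_tuple w); apply/eqP.
Qed.

Definition perm_length (n : nat) (s : 'S_n.+1) : nat :=
  ex_minn (perm_length_subproof s).

Definition reduced_words (n : nat) (s : 'S_n.+1) :
    {set (perm_length s).-tuple 'I_n} :=
  [set w : (perm_length s).-tuple 'I_n | word_perm w == s].

Lemma mem_reduced_words (n : nat) (s : 'S_n.+1) (w : seq 'I_n) :
  (exists2 t, t \in reduced_words s & tval t = w) <->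
  word_perm w = s /\
  (forall w' : seq 'I_n, word_perm w' = s -> size w <= size w').
Proof.
rewrite /reduced_words /perm_length; case: ex_minnP => l /existsP[t0 Et0] minl.
have lmin w' : word_perm w' = s -> l <= size w'.
  move=> Ew'; apply: minl; apply/existsP; exists (in_tuple w').
  exact/eqP.
split=> [[t] | [Ew minw]].
  by rewrite inE => /eqP Et <-; split=> // w' /lmin; rewrite size_tuple.
have sz_w : size w == l.
  by rewrite eqn_leq lmin // -[X in _ <= X](size_tuple t0) minw //; apply/eqP.
by exists (Tuple sz_w); rewrite // inE; apply/eqP.
Qed.

Definition commutation (n : nat) (a b : seq 'I_n) : bool :=
  has (fun k => if drop k a is i :: j :: v
                then (1 < `|i - j|) && (b == take k a ++ [:: j, i & v])
                else false)
      (iota 0 (size a)).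

Lemma commutationP (n : nat) (a b : seq 'I_n) :
  reflect (exists u v i j, [/\ a = u ++ [:: i, j & v], 1 < `|i - j|
                             & b = u ++ [:: j, i & v]])
          (commutation a b).
Proof.
apply: (iffP hasP) => [[k _] | [u [v [i [j [-> far_ij ->]]]]]].
  case Ea: (drop k a) => [|i [|j v]] // /andP[far_ij /eqP ->].
  by exists (take k a), v, i, j; rewrite -Ea cat_take_drop.
exists (size u); first by rewrite mem_iota size_cat /= addnS ltnS leq_addr.
by rewrite drop_size_cat // take_size_cat // far_ij eqxx.
Qed.

Lemma commutation_word_perm (n : nat) (a b : seq 'I_n) :
  commutation a b -> word_perm a = word_perm b.
Proof.
case/commutationP=> u [v [i [j [-> far_ij ->]]]].
rewrite !word_perm_cat /= -!mulgA; congr (_ * _)%g; rewrite !mulgA.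
congr (_ * _)%g; rewrite [RHS]conjgC; congr (_ * _)%g.
have [neq_ij neq_iSj neq_Sij] : [/\ i != j :> nat, i != j.+1 :> nat
                                  & i.+1 != j :> nat].
  split; apply: contraTneq far_ij => e.
  - by rewrite e distnn.
  - by rewrite e distnEl // subSnn.
  - by rewrite -e distnEr // subSnn.
by rewrite /simple_transp tpermJ !tpermD // -val_eqE /= /bump /= ?add1n
  ?eqSS // eq_sym.
Qed.

(* The class of a is taken among the words of the same length as a, because
   commutations preserve the length. *)
Definition commutation_class (n l : nat) (a : l.-tuple 'I_n) :
    {set l.-tuple 'I_n} :=
  [set b : l.-tuple 'I_n |
    connect (fun c d : l.-tuple 'I_n => commutation c d) a b].

Lemma commutation_class_reduced (n : nat) (s : 'S_n.+1)
    (a : (perm_length s).-tuple 'I_n) :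
  a \in reduced_words s -> commutation_class a \subset reduced_words s.
Proof.
rewrite inE => Ea; apply/subsetP=> b; rewrite !inE => /connectP[p].
elim: p a Ea => [|c p IHp] a Ea /=; first by move=> _ ->.
move=> /andP[/commutation_word_perm Eac /IHp]; apply.
by rewrite -Eac.
Qed.

Definition singleton_classes (n : nat) (s : 'S_n.+1) :
    {set (perm_length s).-tuple 'I_n} :=
  [set a in reduced_words s | commutation_class a == [set a]].

(* Main.v *)
(* A reduced word in which consecutive letters differ by 1 and which starts at
   its least letter b climbs at once to its largest letter and never returns to
   it: the strand b, carried past all the others, can no longer move.  So the
   word is a run followed by a word starting at its largest letter.  Cutting
   such a word at the first occurrence of its least letter gives a pair u v
   where u ends, and v starts, at an extreme letter.  The permutation of u v
   determines which of u and v can lose its strand of largest amplitude, and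
   where this strand goes; deleting it gives a shorter pair of the same kind.
   When u ends at its largest letter a and v starts at its least letter b (or
   conversely), a < b leaves a single pair; the only other exception is the case
   where b <= a and u v sends a + 1 to b: then u or v is empty or equal to
   b (b + 1) ... a, which leaves at most four pairs.  Letters and positions are
   integers, so that reversing words and negating letters are symmetries. *)
Require Import Defs.
From mathcomp Require Import all_boot all_fingroup.
From mathcomp Require Import order ssralg ssrnum ssrint zify.

Set Implicit Arguments.
Unset Strict Implicit.
Unset Printing Implicit Defensive.

Import Order.TTheory GRing.Theory Num.Theory.
Local Open Scope ring_scope.

(** * Counting without a finite type *)

(** Duplicate-free lists stand in for cardinals, because words of integers do not form a finite
    type. *)
Definition atmost (T : eqType) (k : nat) (P : T -> Prop) : Prop :=
  forall s : seq T, uniq s -> {in s, forall a, P a} -> (size s <= k)%N.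

Lemma atmost_inj (T U : eqType) (k : nat) (P : T -> Prop) (Q : U -> Prop)
    (f : T -> U) (g : U -> T) :
  (forall a, P a -> Q (f a) /\ g (f a) = a) -> atmost k Q -> atmost k P.
Proof.
move=> PQ kQ s us Ps; rewrite -(size_map f); apply: kQ.
  rewrite map_inj_in_uniq // => a b /Ps/PQ[_ Ea] /Ps/PQ[_ Eb] E.
  by rewrite -Ea E.
by move=> _ /mapP[a /Ps/PQ[Qfa _] ->].
Qed.

Lemma atmost_split (T : eqType) (k l : nat) (P : T -> Prop) (c : pred T) :
  atmost k (fun a => P a /\ c a) -> atmost l (fun a => P a /\ ~~ c a) ->
  atmost (k + l) P.
Proof.
move=> kP lP s us Ps; rewrite -(count_predC c s) -!size_filter leq_add //.
  by apply: kP => [|a]; rewrite ?filter_uniq // mem_filter => /andP[ca /Ps].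
by apply: lP => [|a]; rewrite ?filter_uniq // mem_filter => /andP[ca /Ps].
Qed.

Lemma atmost1 (T : eqType) (P : T -> Prop) :
  (forall a b, P a -> P b -> a = b) -> atmost 1 P.
Proof.
move=> P1 [|a [|b s]] //= /andP[nab _] Ps.
case/negP: nab; rewrite (P1 a b) ?mem_head //; apply: Ps;
by rewrite !inE eqxx ?orbT.
Qed.

Lemma atmost_le (T : eqType) (k l : nat) (P Q : T -> Prop) :
  (k <= l)%N -> (forall a, Q a -> P a) -> atmost k P -> atmost l Q.
Proof.
by move=> kl QP kP s us Qs; apply: leq_trans kl; apply: kP => // a /Qs /QP.
Qed.

(** * Words of integers acting on the integers *)

Definition swap (i p : int) : int :=
  if p == i then i + 1 else if p == i + 1 then i else p.

Definition ev (w : seq int) (p : int) : int := foldr swap p w.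

(** [g] is the permutation accumulated so far; each letter must be an ascent of it, so that it
    increases the length. With [g] the identity this is the inversion criterion for reduced
    words. *)
Fixpoint reduced (g : int -> int) (w : seq int) : bool :=
  if w is i :: w' then (g i < g (i + 1)) && reduced (g \o swap i) w' else true.

Definition adjacent (i j : int) : bool := (j == i + 1) || (i == j + 1).

Fixpoint run (b : int) (k : nat) : seq int :=
  if k is k'.+1 then b :: run (b + 1) k' else [::].

Lemma swapP i p :
  [\/ p = i /\ swap i p = i + 1, p = i + 1 /\ swap i p = i |
      p <> i /\ p <> i + 1 /\ swap i p = p].
Proof.
rewrite /swap; case: eqP => [->|?]; first exact: Or31.
by case: eqP => [->|?]; [exact: Or32 | exact: Or33].
Qed.

Ltac unswap :=
  repeat match goal with |- context [swap ?i ?p] =>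
    lazymatch p with
    | context [swap _ _] => fail
    | _ => case: (swapP i p); generalize (swap i p); intros ? [? ?]
    end end; intros; lia.

Lemma swapK i : involutive (swap i).
Proof. by move=> p; unswap. Qed.

Lemma ev_cat u v p : ev (u ++ v) p = ev u (ev v p).
Proof. by rewrite /ev foldr_cat. Qed.

Lemma ev_rcons u i p : ev (rcons u i) p = ev u (swap i p).
Proof. by rewrite -cats1 ev_cat. Qed.

Lemma ev_revK w : cancel (ev w) (ev (rev w)).
Proof.
by elim: w => //= i w IH p; rewrite rev_cons ev_rcons swapK IH.
Qed.

Lemma ev_Krev w : cancel (ev (rev w)) (ev w).
Proof. by move=> p; rewrite -{1}[w]revK ev_revK. Qed.

Lemma ev_inj w : injective (ev w).
Proof. exact: can_inj (ev_revK w). Qed.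

Lemma ev_rev_eq w w' : ev w =1 ev w' -> ev (rev w) =1 ev (rev w').
Proof. by move=> E p; apply: (@ev_inj w'); rewrite -E !ev_Krev. Qed.

Lemma ev_ge b w p : all (>= b) w -> b <= p -> b <= ev w p.
Proof.
move=> + bp; elim: w => //= i w IH /andP[bi /IH]; unswap.
Qed.

Lemma ev_le b w p : all (<= b) w -> p <= b + 1 -> ev w p <= b + 1.
Proof.
move=> + bp; elim: w => //= i w IH /andP[bi /IH]; unswap.
Qed.

Lemma ev_lt_fix b w p : all (>= b) w -> p < b -> ev w p = p.
Proof.
move=> + bp; elim: w => //= i w IH /andP[bi /IH ->]; unswap.
Qed.

Lemma ev_gt_fix b w p : all (<= b) w -> b + 1 < p -> ev w p = p.
Proof.
move=> + bp; elim: w => //= i w IH /andP[bi /IH ->]; unswap.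
Qed.

Lemma ev_run b k p :
  ev (run b k) p =
  if p == b + k%:Z then b else if (b <= p < b + k%:Z) then p + 1 else p.
Proof.
elim: k b => [|k IH] b /=.
  by case: eqP => ?; [lia | case: ifP; lia].
rewrite IH; case: eqP => ?; first by case: eqP => ?; [unswap | lia].
case: eqP => ?; first by case: ifP => ?; [lia | lia].
by case: ifP => ?; case: ifP => ?; unswap.
Qed.

Lemma run_ge b k : all (>= b) (run b k).
Proof.
elim: k b => //= k IH b; rewrite lexx /=.
by apply: sub_all (IH (b + 1)) => i /=; lia.
Qed.

Lemma run_le b k : all (<= (b + k%:Z - 1)) (run b k).
Proof.
elim: k b => //= k IH b; apply/andP; split; first by lia.
apply: sub_all (IH (b + 1)) => i /=. lia.
Qed.

Lemma run_rcons b k : run b k.+1 = rcons (run b k) (b + k%:Z).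
Proof.
elim: k b => [|k IH] b; first by rewrite /= addr0.
rewrite [LHS]/= -/(run (b + 1) k.+1) IH /=; congr (_ :: rcons _ _); lia.
Qed.

Lemma size_run b k : size (run b k) = k.
Proof. by elim: k b => //= k IH b; rewrite IH. Qed.

(** * Ascents and crossings in reduced words *)

Lemma reduced_ext g h w : g =1 h -> reduced g w = reduced h w.
Proof.
elim: w g h => //= i w IH g h E; rewrite !E; congr (_ && _).
by apply: IH => p /=; rewrite E.
Qed.

Lemma reduced_cat g u v :
  reduced g (u ++ v) = reduced g u && reduced (g \o ev u) v.
Proof. by elim: u g => //= i u IH g; rewrite IH andbA. Qed.

(** The last letter applied that exchanges the two strands sits at an ascent of what precedes it in
    the word, and this ascent is the inequality. *)
Lemma reduced_crossing g w p q : reduced g w -> p < q -> ev w q < ev w p ->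
  g (ev w q) < g (ev w p).
Proof.
elim: w g => [|i w IH] g /=; first by move=> _; lia.
case/andP=> gi rw pq; set P := ev w p; set Q := ev w q => QP.
have [QltP|PltQ|E] := ltgtP Q P; first exact: IH rw pq QltP.
  have [-> ->] : P = i /\ Q = i + 1 by move: QP; unswap; split; lia.
  have -> : swap i (i + 1) = i by unswap.
  by have -> : swap i i = i + 1 by unswap.
by move: QP; rewrite E ltxx.
Qed.

(** A descent at [i] in the reversed word means that [w] already crosses the strands arriving at [i]
    and [i + 1]; [reduced_crossing] then contradicts the ascent of [g] at [i]. *)
Lemma reduced_rev g w : reduced g w -> reduced id (rev w).
Proof.
elim: w g => //= i w IH g /andP[gi rw].
rewrite rev_cons -cats1 reduced_cat (IH _ rw) /= andbT.
have [//|lt|/ev_inj] := ltgtP; last by lia.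
have := reduced_crossing rw lt; rewrite !ev_Krev => /=.
have -> : swap i (i + 1) = i by unswap.
have -> : swap i i = i + 1 by unswap.
by move/(_ ltac:(lia)); lia.
Qed.

Lemma reduced_id g w : reduced g w -> reduced id w.
Proof. by move/reduced_rev/reduced_rev; rewrite revK. Qed.

(** The run exchanges the value [g b] with each of the next [k] values in turn, always at an
    ascent. *)
Lemma reduced_run g b k j : reduced g (run b k) -> (j < k)%N ->
  g b < g (b + j%:Z + 1).
Proof.
elim: k b g j => //= k IH b g j /andP[gb rg].
case: j => [|j] jk; first by rewrite addr0.
have := IH _ _ j rg jk; rewrite /=.
have -> : swap b (b + 1) = b by unswap.
have -> : swap b (b + 1 + j%:Z + 1) = b + j.+1%:Z + 1 by unswap.
by [].
Qed.

(** * Negating and translating letters *)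

Definition neg (w : seq int) : seq int := map -%R w.

Lemma negK : involutive neg.
Proof. by move=> w; rewrite /neg mapK //; exact: opprK. Qed.

(** The letter [- i] exchanges [- i] and [1 - i], the images of [i + 1] and [i] under the reflection
    of [p] to [1 - p]. *)
Lemma ev_neg w p : ev (neg w) p = 1 - ev w (1 - p).
Proof. by elim: w => [|i w IH] /=; [lia|rewrite IH; unswap]. Qed.

Lemma ev_neg_eq w w' : ev w =1 ev w' -> ev (neg w) =1 ev (neg w').
Proof. by move=> E p; rewrite !ev_neg E. Qed.

Lemma reduced_neg g w :
  reduced (fun p => - g (1 - p)) (neg w) = reduced g w.
Proof.
elim: w g => //= i w IH g; congr (_ && _).
  have -> : 1 - - i = i + 1 by lia.
  have -> : 1 - (- i + 1) = i by lia.
  by lia.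
rewrite -IH; apply: reduced_ext => p /=; congr (- g _); unswap.
Qed.

Lemma reduced_addr g w c : reduced (fun p => g p + c) w = reduced g w.
Proof.
elim: w g => //= i w IH g; by rewrite ltrD2r -[in RHS]IH.
Qed.

Lemma reduced_neg_id w : reduced id (neg w) = reduced id w.
Proof.
rewrite -[RHS]reduced_neg -[RHS](reduced_addr _ _ 1).
by apply: reduced_ext => p /=; lia.
Qed.

Definition shift (w : seq int) : seq int := map (fun i => i - 1) w.

Lemma ev_shift w p : ev (shift w) p = ev w (p + 1) - 1.
Proof. by elim: w => [|i w IH] /=; [lia|rewrite IH; unswap]. Qed.

Lemma reduced_shift g w : reduced g (shift w) = reduced (fun p => g (p - 1)) w.
Proof.
elim: w g => //= i w IH g; rewrite IH; congr (_ && _).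
  by have -> : i - 1 + 1 = i + 1 - 1 by lia.
apply: reduced_ext => p /=; congr g; unswap.
Qed.

Lemma sorted_neg w : sorted adjacent (neg w) = sorted adjacent w.
Proof.
by apply: mono_sorted => x y; rewrite /adjacent; lia.
Qed.

Lemma sorted_shift w : sorted adjacent (shift w) = sorted adjacent w.
Proof.
by apply: mono_sorted => x y; rewrite /adjacent; lia.
Qed.

Lemma sorted_rev w : sorted adjacent (rev w) = sorted adjacent w.
Proof.
rewrite rev_sorted; case: w => //= i w; apply: eq_path => x y /=.
by rewrite /adjacent orbC.
Qed.

(* The first letter of w is b and is its least (resp. largest) letter; the empty
   word qualifies for every b. *)
Definition from (up : bool) (b : int) (w : seq int) : bool :=
  (head b w == b) && (if up then all (>= b) w else all (<= b) w).

Lemma from_neg up b w : from (~~ up) (- b) (neg w) = from up b w.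
Proof.
have all_neg (p q : pred int) : (forall i, p (- i) = q i) ->
    all p (neg w) = all q w.
  by move=> pq; rewrite all_map; apply: eq_all => i /=.
rewrite /from; congr (_ && _); first
  by case: w {all_neg} => [|i w] /=; rewrite eqr_opp.
by case: up => /=; apply: all_neg => i /=; lia.
Qed.

Lemma from_shift up b w : from up (b - 1) (shift w) = from up b w.
Proof.
have all_shift (p q : pred int) : (forall i, p (i - 1) = q i) ->
    all p (shift w) = all q w.
  by move=> pq; rewrite all_map; apply: eq_all => i /=.
rewrite /from; congr (_ && _); first
  by case: w {all_shift} => [|i w]; rewrite /= (inj_eq (addIr _)).
by case: up => /=; apply: all_shift => i /=; lia.
Qed.

(** * Rigidity of words that start at an extreme letter *)

Lemma reduced_catl g u v : reduced g (u ++ v) -> reduced g u.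
Proof. by rewrite reduced_cat => /andP[]. Qed.

Lemma reduced_catr g u v : reduced g (u ++ v) -> reduced id v.
Proof. by rewrite reduced_cat => /andP[_ /reduced_id]. Qed.

(* The run has carried the value b, minimal among those moved by the word,
   to the position b + k: no later letter b + k - 1 can move it back. *)
Lemma turn (b : int) (k : nat) (t : seq int) (j : int := b + k%:Z - 2) :
  all (>= b) (j :: t) -> path adjacent j t ->
  reduced (ev (run b k)) (j :: t) -> all (<= j) t.
Proof.
elim/last_ind: t => // t i IH.
rewrite -rcons_cons all_rcons rcons_path => /andP[bi bt] /andP[pt ti].
rewrite -cats1 reduced_cat all_rcons => /andP[rt]; have tj := IH bt pt rt.
rewrite [reduced _ [:: i]]/= andbT => gi.
rewrite tj andbT -[X in is_true X]/(i <= j).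
have lt : last j t <= j.
  case/lastP: t tj {IH bt pt ti rt gi} => //= t x.
  by rewrite all_rcons last_rcons => /andP[].
have [//|ji] := leP i j; move: ti; rewrite /adjacent => ti.
have Ei : i = j + 1 by lia.
have Eb : ev (run b k) (ev (j :: t) (i + 1)) = b.
  have -> : ev (j :: t) (i + 1) = i + 1.
    by apply: (@ev_gt_fix j); [rewrite /= lexx | lia].
  by rewrite ev_run; case: eqP => //; rewrite /j; lia.
have : ev (run b k) (ev (j :: t) i) < b by rewrite -[X in _ < X]Eb.
rewrite ltNge; case/negP; apply: ev_ge; first exact: run_ge.
by apply: ev_ge => //; move: bt => /= /andP[+ _]; lia.
Qed.

(** The run grows while the letters climb; adjacency makes the first descent go to [b + k - 2], and
    [turn] bounds the rest. The last clause is needed because [from] does not force [v'] to be empty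
    when [k] is 0. *)
Lemma from_up_run b v : sorted adjacent v -> reduced id v -> from true b v ->
  exists k v', [/\ v = run b k ++ v', from false (b + k%:Z - 2) v'
                 & k = 0%N -> v' = [::]].
Proof.
case: v => [|i v]; first by exists 0%N, [::]; rewrite /from eqxx.
move=> + + /andP[/eqP /= Ei /andP[_]]; rewrite {i}Ei.
(* Generalizing over the run already read lets the induction on the remaining letters lengthen
   it. *)
suff main k : (0 < k)%N -> sorted adjacent (run b k ++ v) ->
    reduced id (run b k ++ v) -> all (>= b) v ->
    exists k' v', [/\ run b k ++ v = run b k' ++ v',
      from false (b + k'%:Z - 2) v' & k' = 0%N -> v' = [::]].
  exact: (main 1%N).
elim: v k => [|j v IH] k k0 sv rv bv.
  by exists k, [::]; rewrite /from eqxx; split=> //; lia.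
case: k k0 sv rv => // k _; rewrite run_rcons cat_rcons => sv.
have := cat_sorted2 sv => -[_ /= /andP[kj jv]] rv.
have [Ej|Ej] : j = b + k.+1%:Z \/ j = b + k.+1%:Z - 2.
  by move: kj; rewrite /adjacent; lia.
  have := IH k.+2; rewrite run_rcons run_rcons !cat_rcons -Ej; apply=> //.
  by case/andP: bv.
exists k.+1, (j :: v); rewrite run_rcons cat_rcons -Ej; split=> //.
move: rv; rewrite -cat_rcons -run_rcons reduced_cat => /andP[_ rv].
have := @turn b k.+1 v; cbv zeta; rewrite -Ej => turnj.
by rewrite /from /= eqxx lexx (turnj bv jv rv).
Qed.

(** This makes [k] readable from the permutation, as the preimage of [b]. *)
Lemma ev_run_cat (b : int) (k : nat) v :
  from false (b + k%:Z - 2) v -> ev (run b k ++ v) (b + k%:Z) = b.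
Proof.
move=> /andP[_ vk]; rewrite ev_cat (ev_gt_fix vk); last by lia.
by rewrite ev_run eqxx.
Qed.

Lemma ev_eq_catl u v v' : ev (u ++ v) =1 ev (u ++ v') -> ev v =1 ev v'.
Proof. by move=> E p; apply: (@ev_inj u); rewrite -!ev_cat. Qed.

(** The preimage of [b] gives the length of the first run; the remainder starts at its largest
    letter, so the induction continues in the opposite direction. *)
Lemma from_unique up b v v' : from up b v -> from up b v' ->
  sorted adjacent v -> sorted adjacent v' -> reduced id v -> reduced id v' ->
  ev v =1 ev v' -> v = v'.
Proof.
have [N] := ubnP (size v); elim: N up b v v' => // N IH.
have main b v v' : (size v < N.+1)%N -> from true b v -> from true b v' ->
    sorted adjacent v -> sorted adjacent v' -> reduced id v ->
    reduced id v' -> ev v =1 ev v' -> v = v'.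
  move=> szv fv fv' sv sv' rv rv' E.
  have [k [t [Ev ft t0]]] := from_up_run sv rv fv.
  have [k' [t' [Ev' ft' t0']]] := from_up_run sv' rv' fv'.
  have Ek : k' = k.
    suff /ev_inj : ev v' (b + k'%:Z) = ev v' (b + k%:Z) by lia.
    transitivity b; first by rewrite Ev' ev_run_cat.
    by rewrite -E Ev ev_run_cat.
  subst k'; case: k => [|k] in Ev Ev' ft ft' t0 t0' *.
    by rewrite Ev Ev' t0 ?t0'.
  move: sv sv' rv rv' E szv; rewrite Ev Ev' size_cat size_run.
  move=> /cat_sorted2[_ st] /cat_sorted2[_ st'] /reduced_catr rt.
  move=> /reduced_catr rt' /ev_eq_catl E szt; congr (_ ++ _).
  by apply: (IH false _ _ _ _ ft ft') => //; lia.
case=> b v v' szv fv fv' sv sv' rv rv' E; first exact: (main b).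
apply: (can_inj negK); apply: (main (- b)).
- by rewrite size_map.
- by rewrite -[true]/(~~ false) from_neg.
- by rewrite -[true]/(~~ false) from_neg.
- by rewrite sorted_neg.
- by rewrite sorted_neg.
- by rewrite reduced_neg_id.
- by rewrite reduced_neg_id.
- exact: ev_neg_eq.
Qed.

(* The word u ends at its extreme letter a, v starts at its extreme letter b. *)
Definition state (d : bool) (a : int) (e : bool) (b : int) (w : seq int)
    (uv : seq int * seq int) : Prop :=
  [/\ from d a (rev uv.1), from e b uv.2,
      sorted adjacent uv.1 && sorted adjacent uv.2,
      reduced id (uv.1 ++ uv.2) & ev (uv.1 ++ uv.2) =1 ev w].

(** * Symmetries and cancellation for pairs of words *)

Lemma state_neg d a e b w uv : state d a e b w uv ->
  state (~~ d) (- a) (~~ e) (- b) (neg w) (neg uv.1, neg uv.2).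
Proof.
case: uv => u v [fu fv /andP[su sv] r E]; rewrite /state /=.
rewrite -[neg u ++ _]map_cat -/(neg _) reduced_neg_id.
rewrite -[rev (neg u)]map_rev -/(neg _) !from_neg !sorted_neg.
by split=> //; [rewrite su sv|exact: ev_neg_eq].
Qed.

Lemma state_rev d a e b w uv : state d a e b w uv ->
  state e b d a (rev w) (rev uv.2, rev uv.1).
Proof.
case: uv => u v [fu fv /andP[su sv] r E]; rewrite /state /= -rev_cat revK.
split=> //; first by rewrite !sorted_rev su sv.
  exact: reduced_rev r.
exact: ev_rev_eq.
Qed.

Lemma state_eql d a e b w u v v' :
  state d a e b w (u, v) -> state d a e b w (u, v') -> v = v'.
Proof.
move=> [_ /= fv /andP[_ sv] /reduced_catr rv E].
move=> [_ /= fv' /andP[_ sv'] /reduced_catr rv' E'].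
apply: (from_unique fv fv') => //; apply: (@ev_eq_catl u) => p.
by rewrite E E'.
Qed.

Lemma state_eqr d a e b w u u' v :
  state d a e b w (u, v) -> state d a e b w (u', v) -> u = u'.
Proof.
move=> /state_rev S /state_rev S'; apply: (can_inj revK).
exact: state_eql S S'.
Qed.

(** The bound [N] on the total size only drives the induction; the constant 4 is uniform in it. *)
Definition bounded (N : nat) (d : bool) (a : int) (e : bool) (b : int) : Prop :=
  forall w, atmost 4 (fun uv => state d a e b w uv /\
                               (size uv.1 + size uv.2 < N)%N).

Lemma bounded_neg N d a e b :
  bounded N (~~ d) (- a) (~~ e) (- b) -> bounded N d a e b.
Proof.
move=> bnd w; pose f (uv : seq int * seq int) := (neg uv.1, neg uv.2).
apply: (atmost_inj (f := f) (g := f)) (bnd (neg w)) => uv [S sz].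
rewrite /f /= !size_map !negK -surjective_pairing.
by split=> //; split=> //; apply: state_neg S.
Qed.

Lemma bounded_rev N d a e b : bounded N e b d a -> bounded N d a e b.
Proof.
move=> bnd w; pose f (uv : seq int * seq int) := (rev uv.2, rev uv.1).
apply: (atmost_inj (f := f) (g := f)) (bnd (rev w)) => uv [S sz].
rewrite /f /= !size_rev !revK -surjective_pairing addnC.
by split=> //; split=> //; apply: state_rev S.
Qed.

(** * Deleting a strand *)

Lemma reduced_range (b c d : int) (g h : int -> int) w :
  (forall p, b <= p <= c + 1 -> h p = g p + d) ->
  all (>= b) w -> all (<= c) w -> reduced g w -> reduced h w.
Proof.
elim: w g h => //= i w IH g h gh /andP[bi bw] /andP[ic cw] /andP[gi rg].
rewrite !gh ?ltrD2r ?gi /=; try lia.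
by apply: IH rg => // p pbc /=; apply: gh; move: pbc; unswap.
Qed.

(* Deleting the strand that the initial run of v carries from b to b + k lowers
   the positions above b on the side of u by one and leaves the rest of v
   unchanged. *)
Lemma ev_peel (b : int) (k : nat) (u v : seq int) (p : int) :
  all (>= b) v -> all (<= (b + k%:Z - 2)) v -> b <= p ->
  ev (shift u ++ v) p =
  ev (u ++ run b k ++ v) (if p < b + k%:Z then p else p + 1) - 1.
Proof.
move=> bv vk bp; rewrite !ev_cat ev_shift ev_run; congr (ev u _ - 1).
case: (ltP p (b + k%:Z)) => pk.
  have := ev_ge bv bp.
have : p <= b + k%:Z - 2 + 1 by lia.
  move=> /(ev_le vk).
  by move=> ? ?; case: eqP => ?; [lia | case: ifP; lia].
rewrite !(ev_gt_fix vk); try lia.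
by case: eqP => ?; [lia | case: ifP; lia].
Qed.

Lemma reduced_peel (b : int) (k : nat) (u v : seq int) :
  all (>= b) v -> all (<= (b + k%:Z - 2)) v ->
  reduced id (u ++ run b k ++ v) -> reduced id (shift u ++ v).
Proof.
move=> bv vk; rewrite catA reduced_cat [in X in _ -> X]reduced_cat.
move=> /andP[/reduced_catl ru rv]; rewrite reduced_shift reduced_addr ru /=.
apply: (reduced_range (d := -1)) bv vk rv => p pb.
rewrite /= ev_shift ev_cat ev_run.
by case: eqP => ?; [lia | case: ifP => //; lia].
Qed.

(** Since [u] fixes [b], the preimage of [b] under [w] gives all pairs the same [k]. Deleting the
    run is then injective and sends them to pairs of one common permutation. *)
Lemma peel N d (a b : int) w :
  (forall k : nat, ev w (b + k%:Z) = b ->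
    bounded N d (a - 1) false (b + k%:Z - 2)) ->
  atmost 4 (fun uv => [/\ state d a true b w uv, all (> b) uv.1
                        & (size uv.1 + size uv.2 < N.+1)%N]).
Proof.
move=> bnd [|uv0 s'] // us; set s := uv0 :: s' => Ps.
have shape uv : uv \in s -> exists k v, [/\ uv.2 = run b k ++ v,
    from false (b + k%:Z - 2) v, k = 0%N -> v = [::]
    & ev w (b + k%:Z) = b].
  case: uv => u v /Ps[[/= _ fv /andP[_ sv] r E] bu _].
  have [k [t [Ev ft t0]]] := from_up_run sv (reduced_catr r) fv.
  exists k, t; split=> //; rewrite -E Ev ev_cat ev_run_cat //.
  apply: (@ev_lt_fix (b + 1)); last by lia.
  by apply: sub_all bu => i /=; lia.
have [k0 [_ [_ _ _ Ek0]]] := shape uv0 (mem_head _ _).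
have {}shape uv : uv \in s -> exists2 v, uv.2 = run b k0 ++ v
    & from false (b + k0%:Z - 2) v /\ (k0 = 0%N -> v = [::]).
  move=> /shape[k [v [Ev fv v0 Ek]]].
  have -> : k0 = k by have := Ek0; rewrite -[X in _ = X]Ek => /ev_inj; lia.
  by exists v.
(* If the first run is empty then so is [v], and cancellation leaves one pair. *)
have [k00 | k0_gt0] := posnP k0.
  apply: (@leq_trans 1) => //.
  apply: (@atmost1 _ (fun uv => uv \in s) _ s us) => // -[u v] [u' v'] su su'.
  have [[S _ _] [S' _ _]] := (Ps _ su, Ps _ su').
  have v0 uv : uv \in s -> uv.2 = [::].
    by move=> /shape[x -> [_ /(_ k00) ->]]; rewrite k00.
  have /= Ev := v0 _ su; have /= Ev' := v0 _ su'; subst v v'.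
  by rewrite (state_eqr S S').
pose f (uv : seq int * seq int) := (shift uv.1, drop k0 uv.2).
pose g (uv : seq int * seq int) := (map (+%R^~ 1) uv.1, run b k0 ++ uv.2).
(* The shortened permutation depends on [w], [b] and [k0] only, not on the pair. *)
have evf uv : uv \in s -> forall p, ev ((f uv).1 ++ (f uv).2) p =
    if p < b then p
    else ev w (if p < b + k0%:Z then p else p + 1) - 1.
  move=> suv; have [[_ fv _ _ E] bu _] := Ps _ suv.
  have [v Ev [fv' _]] := shape _ suv => p.
  have vb : all (>= b) v.
    by case/andP: fv => _; rewrite Ev all_cat => /andP[].
  rewrite -E /f Ev drop_size_cat ?size_run //=; case: ltP => pb.
    apply: (@ev_lt_fix b) => //; rewrite all_cat vb andbT all_map.
    by apply: sub_all bu => i /=; lia.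
  by apply: ev_peel => //; apply: (andP fv').2.
have := bnd k0 Ek0 ((f uv0).1 ++ (f uv0).2).
move/(@atmost_inj _ _ _ (fun uv => uv \in s) _ f g); apply=> // uv suv.
have [[fu fv /andP[su sv] r _] bu sz] := Ps _ suv.
have [v Ev [fv' _]] := shape _ suv.
have vb : all (>= b) v.
  by case/andP: fv => _; rewrite Ev all_cat => /andP[].
split; last first.
  case: uv Ev {suv fu fv su sv r bu sz} => u v' /= ->.
  rewrite /g /f /= drop_size_cat ?size_run // -map_comp map_id_in //.
  by move=> i _ /=; lia.
have evf0 p : ev ((f uv).1 ++ (f uv).2) p = ev ((f uv0).1 ++ (f uv0).2) p.
  by rewrite !evf // mem_head.
move: evf0; rewrite /f Ev drop_size_cat ?size_run //= => evf0.
split; last first.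
  move: sz; rewrite /= Ev size_cat size_run /shift size_map ltnS.
  by apply: leq_trans; rewrite -addnS leq_add2l -add1n leq_add2r.
split=> //=.
- by rewrite -map_rev -/(shift _) from_shift.
- rewrite sorted_shift su /=; move: sv; rewrite Ev.
  by move=> /cat_sorted2[].
- by apply: reduced_peel vb (andP fv').2 _; rewrite -Ev.
Qed.

(** * Pairs with opposite directions *)

Lemma neg_rev_run (b : int) k : rev (neg (run (- b) k)) = run (b + 1 - k%:Z) k.
Proof.
elim: k => // k IH; rewrite run_rcons /neg map_rcons rev_rcons IH /=.
by congr (_ :: run _ _); lia.
Qed.

Lemma to_down_run (b : int) (u : seq int) :
  sorted adjacent u -> reduced id u -> from false b (rev u) ->
  exists k u', [/\ u = u' ++ run (b + 1 - k%:Z) k,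
    from true (b + 2 - k%:Z) (rev u') & k = 0%N -> u' = [::]].
Proof.
move=> su ru; rewrite -from_neg /= => fu.
have [||k [t [Et ft t0]]] := from_up_run _ _ fu.
- by rewrite sorted_neg sorted_rev.
- by rewrite reduced_neg_id; apply: reduced_rev ru.
exists k, (rev (neg t)); split.
- by rewrite -neg_rev_run -rev_cat /neg -map_cat -Et -/(neg _) negK revK.
- rewrite revK; have -> : b + 2 - k%:Z = - (- b + k%:Z - 2) by lia.
  by rewrite -[true]/(~~ false) from_neg.
- by move=> /t0 ->.
Qed.

(** For two such pairs, [rev u' ++ u] and [v' ++ rev v] act alike. The former moves only points up
    to [a + 1], the latter only points from [b] on; these ranges share at most one point, so both
    act trivially. *)
Lemma state_disjoint (a b : int) w : a < b ->
  atmost 1 (state false a true b w).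
Proof.
move=> ab; apply: atmost1 => -[u v] [u' v'] S S'.
suff uu' : u = u' by rewrite uu' in S *; rewrite (state_eql S S').
case: S S' => /= fu fv /andP[su sv] r E [/= fu' fv' /andP[su' sv'] r' E'].
apply: (can_inj revK).
apply: (from_unique fu fu'); rewrite ?sorted_rev //.
- by apply: reduced_rev; apply: reduced_catl r.
- by apply: reduced_rev; apply: reduced_catl r'.
apply: ev_rev_eq => p; apply: (@ev_inj (rev u')); rewrite ev_revK -ev_cat.
have Euv : ev (rev u' ++ u) p = ev (v' ++ rev v) p.
  rewrite !ev_cat; apply: (@ev_inj u'); rewrite ev_Krev -[RHS]ev_cat E' -E.
  by rewrite ev_cat ev_Krev.
have ulea : all (<= a) (rev u' ++ u).
  by rewrite all_cat (andP fu').2 -all_rev (andP fu).2.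
have vgeb : all (>= b) (v' ++ rev v).
  by rewrite all_cat all_rev (andP fv').2 (andP fv).2.
have [pb|bp] := ltP p b; first by rewrite Euv (ev_lt_fix vgeb).
have [pa|ap] := ltP (a + 1) p; first by rewrite (ev_gt_fix ulea).
have := ev_le ulea ap; have := ev_ge vgeb bp; rewrite -Euv.
by move: (ev _ p) => q; clear - ab bp ap; lia.
Qed.

Lemma state_runs (a b : int) (w u v : seq int) :
  state false a true b w (u, v) ->
  exists k u' l v',
  [/\ [/\ u = u' ++ run (a + 1 - k%:Z) k, from true (a + 2 - k%:Z) (rev u')
        & k = 0%N -> u' = [::]],
      [/\ v = run b l ++ v', from false (b + l%:Z - 2) v'
        & l = 0%N -> v' = [::]],
      all (>= (a + 1 - k%:Z)) u /\ ev u (a + 1) = a + 1 - k%:Z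
    & all (<= (b + l%:Z - 1)) v /\ ev v (b + l%:Z) = b].
Proof.
case=> /= fu fv /andP[su sv] r _.
have [k [u' [Eu fu' u0]]] := to_down_run su (reduced_catl r) fu.
have [l [v' [Ev fv' v0]]] := from_up_run sv (reduced_catr r) fv.
have u'ge : all (>= (a + 2 - k%:Z)) u' by rewrite -all_rev (andP fu').2.
exists k, u', l, v'; split=> //; split; rewrite ?Eu ?Ev.
- by rewrite all_cat run_ge andbT; apply: sub_all u'ge => i /=; lia.
- rewrite ev_cat ev_run; case: eqP => [_|]; last by lia.
  by apply: ev_lt_fix u'ge _; lia.
- rewrite all_cat run_le; apply: sub_all (andP fv').2 => i /=; lia.
- exact: ev_run_cat.
Qed.

(* Otherwise the strand that u brings from a + 1 down to its least position
   would be crossed again by the one that v takes up from b. *)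
Lemma overlap (a b : int) (u v : seq int) (k l : nat) :
  b <= a -> a + 1 - k%:Z <= b -> all (>= (a + 1 - k%:Z)) u ->
  ev u (a + 1) = a + 1 - k%:Z -> reduced id (u ++ run b l ++ v) ->
  b + l%:Z <= a.
Proof.
move=> ba kb ug ua; rewrite reduced_cat => /andP[_ /reduced_catl rl].
have [//|la] := leP (b + l%:Z) a.
have [lt|] := leP l (absz (a - b)%R); first by lia.
move=> /(reduced_run rl); have -> : b + (absz (a - b)%R) + 1 = a + 1 by lia.
by rewrite /= ua; have := ev_ge ug kb; move: (ev u b) => q; lia.
Qed.

(** If the last run of [u] reached [b] or lower, [overlap] would make [v] fix [a + 1], and [w] would
    send [a + 1] to a point at most [b]. *)
Lemma state_right (a b : int) (w u v : seq int) :
  b <= a -> b < ev w (a + 1) -> state false a true b w (u, v) -> all (> b) u.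
Proof.
move=> ba bw S; have [k [u' [l [v' [[Eu _ _] [Ev _ _] [ug ua] [vl vb]]]]]] :=
  state_runs S.
have [kb|bk] := leP (a + 1 - k%:Z) b; last first.
  by apply: sub_all ug => i /=; lia.
case: S => _ _ _ /= r E.
have la : b + l%:Z <= a by apply: (@overlap a b u v' k l) => //; rewrite -Ev.
by move: bw; rewrite -E ev_cat (ev_gt_fix vl); lia.
Qed.

(** Either [overlap] bounds the first run of [v], or [u] and [v] both preserve the points from [b]
    on, against the hypothesis on [a + 1]. *)
Lemma state_left (a b : int) (w u v : seq int) :
  b <= a -> ev w (a + 1) < b -> state false a true b w (u, v) ->
  all (fun i => i < a) v.
Proof.
move=> ba bw S; have [k [u' [l [v' [[Eu _ _] [Ev _ _] [ug ua] [vl vb]]]]]] :=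
  state_runs S.
case: S => _ fv _ /= r E.
have [kb|bk] := leP (a + 1 - k%:Z) b.
  have la : b + l%:Z <= a by apply: (@overlap a b u v' k l) => //; rewrite -Ev.
  by apply: sub_all vl => i /=; lia.
move: bw; rewrite -E ev_cat ltNge; case/negP; apply: ev_ge.
  by apply: sub_all ug => i /=; lia.
by apply: ev_ge; [exact: (andP fv).2 | lia].
Qed.

(** The strand from [a + 1] to [b] lies in the last run of [u] or in the first run of [v], and that
    run is [run b m]. If the word containing it has further letters, the other word is empty. *)
Lemma state_center (a b : int) (w u v : seq int) (m := absz (a + 1 - b)%R) :
  b <= a -> ev w (a + 1) = b -> state false a true b w (u, v) ->
  [|| u == [::], v == [::], u == run b m | v == run b m].
Proof.
move=> ba bw S.
have [k [u' [l [v' [[Eu fu' u0] [Ev fv' v0] [ug ua] [vl vb]]]]]] :=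
  state_runs S.
case: S => /= fu fv _ r E.
have [kb|bk] := leP (a + 1 - k%:Z) b.
  have la : b + l%:Z <= a by apply: (@overlap a b u v' k l) => //; rewrite -Ev.
  have bk : b = a + 1 - k%:Z.
    by rewrite -ua -bw -E ev_cat (ev_gt_fix vl) //; lia.
  have mk : k = m by rewrite /m; lia.
  subst k; move: Eu fu'; rewrite -bk => Eu.
  case/lastP: u' Eu {u0} => [->|u' i Eu]; first by rewrite eqxx !orbT.
  have -> : a + 2 - m%:Z = b + 1 by lia.
  rewrite rev_rcons => /andP[/eqP /= Ei _].
  case: v fv r {Ev vl vb E} => [|j v] /andP[/eqP /= Ej _].
    by rewrite orbT.
  rewrite reduced_cat => /andP[ru /= /andP[+ _]]; rewrite {}Ej.
  have ia : i <= a.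
    have : all (<= a) u by rewrite -all_rev (andP fu).2.
    by rewrite Eu all_cat all_rcons => /andP[/andP[]].
  have : reduced id (rcons u' i) by move: ru; rewrite Eu => /reduced_catl.
  rewrite -cats1 reduced_cat => /andP[_ /= /andP[ri _]].
  rewrite Eu {}Ei -cats1 in ia ri *.
  (* The run carries [b] and [b + 1] to [b + 1] and [b + 2], which the letter [b + 1] before it
     exchanges. The ascent at this letter and the one at the first letter of [v] are opposite
     inequalities. *)
  rewrite !ev_cat !ev_run.
  case: eqP => [?|_]; first by lia.
  case: ifP => [_|]; last by lia.
  case: eqP => [?|_]; first by lia.
  case: ifP => [_|]; last by lia.
  rewrite /=.
  have -> : swap (b + 1) (b + 1) = b + 1 + 1 by unswap.
  have -> : swap (b + 1) (b + 1 + 1) = b + 1 by unswap.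
  by move: ri; move: (ev _ _) (ev _ _) => x y; lia.
have ub : all (> b) u by apply: sub_all ug => i /=; lia.
have lm : b + l%:Z = a + 1.
  apply: (@ev_inj w); rewrite bw -E ev_cat vb.
  by apply: (@ev_lt_fix (b + 1)); [apply: sub_all ub => i /=; lia | lia].
have ml : l = m by rewrite /m; lia.
subst l; case: v' Ev fv' {v0} => [->|i v' Ev].
  by rewrite cats0 eqxx !orbT.
have [k0|k0] := posnP k; first by rewrite Eu k0 u0.
move=> /andP[/eqP /= Ei _].
have bi : b <= i.
  by move: (andP fv).2; rewrite /= Ev all_cat /= => /and3P[].
move: r; rewrite Ev !reduced_cat => /and3P[_ _ /= /andP[+ _]].
rewrite {}Ei in bi *; rewrite lm in bi *.
(* The first letter of [v'] is [a - 1], and the run raises [a - 1] and [a] by one, so the ascent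
   reads [ev u a < ev u (a + 1)]. But [ev u (a + 1)] is the least value of [u] on the points from
   [a + 1 - k] on. *)
rewrite !ev_run lm.
case: eqP => [?|_]; first by lia.
case: ifP => [_|]; last by lia.
case: eqP => [?|_]; first by lia.
case: ifP => [_|]; last by lia.
have -> : a + 1 - 2 + 1 + 1 = a + 1 by lia.
have -> : a + 1 - 2 + 1 = a by lia.
rewrite ua; have ka : a + 1 - k%:Z <= a by lia.
by have := ev_ge ug ka; move: (ev u a) => q; lia.
Qed.

Lemma bounded_opposite N (a b : int) :
  (forall (d : bool) (c c' : int), c != c' -> bounded N d c d c') ->
  bounded N.+1 false a true b.
Proof.
move=> IH w; have [ab|ba] := ltP a b.
  by apply: atmost_le _ _ (state_disjoint (w := w) ab) => // uv [].
have [lt|gt|eq] := ltgtP (ev w (a + 1)) b.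
(* Reversing and negating exchanges the roles of [u] and [v], so that [peel] shortens the original
   [u]. *)
- pose f (uv : seq int * seq int) := (neg (rev uv.2), neg (rev uv.1)).
  have fK : involutive f.
    by case=> u v; rewrite /f /= /neg -!map_rev -!/(neg _) !revK !negK.
  pose P uv := [/\ state false (- b) true (- a) (neg (rev w)) uv,
    all (> - a) uv.1 & (size uv.1 + size uv.2 < N.+1)%N].
  apply: (atmost_inj (f := f) (g := f) (Q := P)).
    move=> [u v] [S sz]; split; last exact: fK.
    have va := state_left ba lt S.
    split; first exact: state_neg (state_rev S).
      by rewrite all_map all_rev; apply: sub_all va => i /=; lia.
    by rewrite /= !size_map !size_rev addnC.
  apply: peel => k; rewrite ev_neg => Ek; apply: IH; apply/eqP => ak.
  move: Ek; set q := ev _ _ => Ek; have : q = a + 1 by clearbody q; lia.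
  by move/(congr1 (ev w)); rewrite /q ev_Krev; move: lt; case: ltgtP => //; lia.
- pose P uv := [/\ state false a true b w uv, all (> b) uv.1
    & (size uv.1 + size uv.2 < N.+1)%N].
  apply: (@atmost_le _ 4 4 P) => // [[u v] [S sz]|].
    by split=> //; apply: state_right ba gt S.
  (* The new extremes could only coincide if [w] sent [a + 1] to [b]. *)
  apply: peel => k Ek; apply: IH; apply/eqP => ak.
  have ka : b + k%:Z = a + 1 by lia.
  by move: gt; rewrite -ka Ek ltxx.
pose r := run b `|(a + 1 - b)%R|%N.
pose S uv := state false a true b w uv /\ (size uv.1 + size uv.2 < N.+1)%N.
have left1 x : atmost 1 (fun uv => S uv /\ uv.1 == x).
  apply: atmost1 => -[u v] [u' v'] [[Suv _] /= /eqP Eu] [[Suv' _] /= /eqP Eu'].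
  by subst u u'; rewrite (state_eql Suv Suv').
have right1 x : atmost 1 (fun uv => S uv /\ uv.2 == x).
  apply: atmost1 => -[u v] [u' v'] [[Suv _] /= /eqP Ev] [[Suv' _] /= /eqP Ev'].
  by subst v v'; rewrite (state_eqr Suv Suv').
(* Each of the four shapes fixes one word, which determines the other. *)
apply: (@atmost_split _ 1 3 _ (fun uv => uv.1 == [::])); first exact: left1.
apply: (@atmost_split _ 1 2 _ (fun uv => uv.2 == [::])).
  by apply: atmost_le _ _ (right1 [::]) => // uv [[? _] ?].
apply: (@atmost_split _ 1 1 _ (fun uv => uv.1 == r)).
  by apply: atmost_le _ _ (left1 r) => // uv [[[? _] _] ?].
apply: atmost_le _ _ (right1 r) => // -[u v] [[[[Suv sz] /= u0] v0] ur].
split=> //=; have := state_center ba eq Suv.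
by rewrite (negPf u0) (negPf v0) (negPf ur).
Qed.

(** * The induction on the total size *)

(** Deleting a strand reverses the direction of the shortened word, so equal and opposite directions
    alternate. For equal directions, distinct extremes ensure that one word avoids the extreme
    letter of the other. *)
Lemma bounded_all N d (a : int) e (b : int) :
  (d != e) || (a != b) -> bounded N d a e b.
Proof.
elim: N d a e b => [|N IH] d a e b de.
  by move=> w [|uv s] // _ /(_ uv (mem_head _ _)) [_]; lia.
have opp c c' : bounded N.+1 false c true c'.
  by apply: bounded_opposite => d' x x' xx'; apply: IH; rewrite xx' orbT.
have same c c' : c' < c -> bounded N.+1 true c true c'.
  move=> cc' w.
  pose P uv := [/\ state true c true c' w uv, all (> c') uv.1
    & (size uv.1 + size uv.2 < N.+1)%N].
  apply: (@atmost_le _ 4 4 P) => // [[u v] [S sz]|].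
    split=> //; case: S => /= /andP[_]; rewrite all_rev => uc _ _ _ _.
    by apply: sub_all uc => i /=; lia.
  by apply: peel => k _; apply: IH.
have same_up c c' : c != c' -> bounded N.+1 true c true c'.
  rewrite neq_lt => /orP[cc' | ]; last exact: same.
  by apply: bounded_rev; apply: same.
case: d e de => [] [] /= ab; first exact: same_up.
- by apply: bounded_neg; apply: opp.
- exact: opp.
by apply: bounded_neg; apply: same_up; rewrite eqr_opp.
Qed.

(** * Cutting a word at its least letter *)

Lemma exists_min (w : seq int) :
  w != [::] -> exists b : int, b \in w /\ all (>= b) w.
Proof.
elim: w => // i w IH _; case: w IH => [_|j w /(_ isT) [b [bw wb]]].
  by exists i; rewrite mem_head /= lexx.
have [ib|bi] := leP i b.
  exists i; rewrite mem_head /=; split=> //; rewrite lexx /=.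
  by apply: sub_all wb => x /=; lia.
exists b; rewrite inE bw orbT; split=> //.
by apply/andP; split; [exact: ltW | exact: wb].
Qed.

(** The letter before the first [b] is adjacent to [b] and larger, hence [b + 1]. The point [b] is
    moved because the first run of the second part sends a larger point to [b], which the first part
    fixes. *)
Lemma cut_min (b : int) (w : seq int) (i := index b w) :
  b \in w -> all (>= b) w -> sorted adjacent w -> reduced id w ->
  state true (b + 1) true b w (take i w, drop i w) /\ ev w b != b.
Proof.
move=> bw wb sw rw; have := cat_take_drop i w; rewrite /i.
set u := take _ _; set v := drop _ _ => Ew.
have Ev : v = b :: behead v.
  by rewrite /v /i (drop_nth 0) ?index_mem // nth_index.
have bu : b \notin u.
  by apply/negP => bu; have := index_ltn bu; rewrite ltnn.
clearbody u v.
have ub : all (>= (b + 1)) u.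
  apply/allP => j ju; have : b <= j.
    by apply: (allP wb); rewrite -Ew mem_cat ju.
  have : j != b by apply: contraNneq bu => <-.
  by rewrite /=; lia.
have vb : all (>= b) v by move: wb; rewrite -Ew all_cat => /andP[].
have [su sv] : sorted adjacent u /\ sorted adjacent v.
  by move: sw; rewrite -Ew => /cat_sorted2[].
have fv : from true b v by rewrite /from vb Ev /= eqxx.
have fu : from true (b + 1) (rev u).
  rewrite /from all_rev ub andbT; case/lastP: u {bu su} Ew ub => // u j.
  rewrite rev_rcons all_rcons /= cat_rcons Ev => Ew /andP[bj _].
  move: sw; rewrite -Ew => /cat_sorted2[_ /= /andP[+ _]].
  by rewrite /adjacent; lia.
split; first by split; rewrite /= ?su ?Ew.
have rv : reduced id v by move: rw; rewrite -Ew => /reduced_catr.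
have [k [v' [Ev' fv' v0]]] := from_up_run sv rv fv.
have k0 : (0 < k)%N.
  by case: k Ev' fv' v0 => // + _ /(_ erefl) v0; rewrite v0 Ev.
have Ek : ev w (b + k%:Z) = b.
  rewrite -Ew ev_cat Ev' ev_run_cat //.
  by apply: ev_lt_fix ub _; rewrite ltrDl.
apply/eqP; rewrite -[X in _ = X]Ek => /ev_inj; clear - k0; lia.
Qed.

(** The least letter is the least point moved by the permutation, so all the words are cut at the
    same [b]; concatenation undoes the cut. *)
Lemma words_bound (w : seq int) :
  atmost 4 (fun x => [/\ sorted adjacent x, reduced id x & ev x =1 ev w]).
Proof.
move=> [|x0 s'] // us; set s := x0 :: s' => Ps.
have P0 := Ps _ (mem_head _ _).
have [x00|x0n] := eqVneq x0 [::].
  apply: (@leq_trans 1) => //.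
  apply: (@atmost1 _ (fun x => x \in s) _ s us) => //.
  suff nil x : x \in s -> x = [::] by move=> x y /nil -> /nil.
  move=> /Ps[sx rx Ex]; apply/eqP; apply: contraT => /exists_min[b [bx xb]].
  have [_ /eqP[]] := cut_min bx xb sx rx.
  by case: P0 => _ _ E0; rewrite Ex -E0 x00.
have [b [bx0 x0b]] := exists_min x0n.
have same x : x \in s -> b \in x /\ all (>= b) x.
  move=> /[dup] xs /Ps[sx rx Ex]; case: P0 => s0 r0 E0.
  have xn : x != [::].
    apply/eqP => x_nil; have [_ /eqP[]] := cut_min bx0 x0b s0 r0.
    by rewrite E0 -Ex x_nil.
  have [c [cx xc]] := exists_min xn.
  suff -> : b = c by [].
  have [bc|cb|//] := ltgtP b c.
    have [_ /eqP[]] := cut_min bx0 x0b s0 r0.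
    by rewrite E0 -Ex (ev_lt_fix xc).
  have [_ /eqP[]] := cut_min cx xc sx rx.
  by rewrite Ex -E0 (ev_lt_fix x0b).
pose f (x : seq int) := (take (index b x) x, drop (index b x) x).
pose g (uv : seq int * seq int) := uv.1 ++ uv.2.
have bnd := @bounded_all (\max_(x <- s) size x).+1 true (b + 1) true b.
apply: (@atmost_inj _ _ _ (fun x => x \in s) _ f g _ (bnd _ w) s us) => //.
  move=> x xs; have [sx rx Ex] := Ps _ xs; have [bx xb] := same _ xs.
  rewrite /g /f /= -size_cat cat_take_drop ltnS.
  split=> //; split; last by rewrite (big_rem x) // leq_maxl.
  have [[fu fv suv r E] _] := cut_min bx xb sx rx.
  by split=> // p; rewrite E Ex.
by apply/orP; right; lia.
Qed.

(** * The exchange property *)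

(** The strands starting at [i] and [i + 1] cross at some letter of [u]; deleting this letter has
    the effect of appending [i]. *)
Lemma exchange u i : ev u (i + 1) < ev u i ->
  exists x, [/\ subseq x u, (size x < size u)%N & ev x =1 ev (rcons u i)].
Proof.
elim: u => [|j u IH] /=; first by lia.
have [/IH [x [xu sx Ex]] _|lt gt|/ev_inj] := ltgtP (ev u (i + 1)) (ev u i).
- by exists (j :: x); split=> [|//|p]; rewrite /= ?eqxx ?Ex.
- exists u; split=> // [|p]; first exact: subseq_cons.
  rewrite /= ev_rcons; apply: (can_inj (swapK j)); rewrite swapK.
  have [ui ui1] : ev u i = j /\ ev u (i + 1) = j + 1.
    by move: gt; unswap.
  have [->|pi] := eqVneq p i.
    have -> : swap i i = i + 1 by unswap.
    by rewrite ui ui1; unswap.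
  have [->|pi1] := eqVneq p (i + 1).
    have -> : swap i (i + 1) = i by unswap.
    by rewrite ui ui1; unswap.
  have -> : swap i p = p by unswap.
  have : ev u p != j by rewrite -ui (inj_eq (@ev_inj u)).
  have : ev u p != j + 1 by rewrite -ui1 (inj_eq (@ev_inj u)).
  by unswap.
by lia.
Qed.

Lemma not_reduced (w : seq int) : ~~ reduced id w ->
  exists x, [/\ subseq x w, (size x < size w)%N & ev x =1 ev w].
Proof.
elim/last_ind: w => // w i IH.
rewrite -{1}cats1 reduced_cat /= andbT size_rcons.
have [_ /=|/IH [x [xw sx Ex]] _] := boolP (reduced id w); last first.
  exists (rcons x i); rewrite size_rcons; split=> // [|p].
    by rewrite -!cats1 cat_subseq.
  by rewrite !ev_rcons Ex.
rewrite -leNgt le_eqVlt => /orP[/eqP/ev_inj|]; first by lia.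
move=> /exchange [x [xw sx Ex]]; exists x; split=> //.
  exact: subseq_trans xw (subseq_rcons _ _).
exact: ltnW.
Qed.

(** * From words over ['I_n] to words of integers *)

Definition letters (n : nat) (w : seq 'I_n) : seq int :=
  [seq Posz (val i) | i <- w].

Lemma ev_letters n (w : seq 'I_n) (x : 'I_n.+1) :
  ev (letters w) (Posz (val x)) = Posz (val (word_perm w x)).
Proof.
rewrite word_permE; elim: w => //= i w ->; set y := foldr _ _ _.
rewrite /simple_transp; case: tpermP => [->|->|/eqP + /eqP].
- by rewrite /= /bump /=; unswap.
- by rewrite /= /bump /=; unswap.
by rewrite -!val_eqE /= /bump /=; unswap.
Qed.

(** No letter moves an integer outside the range from 0 to [n], so agreement on the finite set
    extends to all integers. *)
Lemma ev_letters_eq n (w w' : seq 'I_n) :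
  word_perm w = word_perm w' <-> ev (letters w) =1 ev (letters w').
Proof.
split=> [E p|E]; last first.
  apply/permP => x; apply: val_inj; have := E (Posz (val x)).
  by rewrite !ev_letters => -[].
have w0 (x : seq 'I_n) : all (>= 0) (letters x).
  by rewrite all_map; apply/allP.
have wn (x : seq 'I_n) : all (<= (n%:Z - 1)) (letters x).
  by rewrite all_map; apply/allP => i _ /=; have := ltn_ord i; lia.
have [p0|p0] := ltP p 0; first by rewrite !(@ev_lt_fix 0).
have [pn|np] := leP p n%:Z; last by rewrite !(@ev_gt_fix (n%:Z - 1)) //; lia.
have pn' : (absz p < n.+1)%N by lia.
have -> : p = Posz (val (Ordinal pn')) by rewrite /=; lia.
by rewrite !ev_letters E.
Qed.

Lemma letters_reduced n (s : 'S_n.+1) (a : (perm_length s).-tuple 'I_n) :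
  a \in reduced_words s -> reduced id (letters a).
Proof.
move=> sa.
have [Ea mina] := (mem_reduced_words s a).1 (ex_intro2 _ _ a sa erefl).
(* A subword of [letters a] is again the image of a word over ['I_n], so the minimality of [a]
   applies to it. *)
apply: contraT => /not_reduced [x [/subseqP [m _ ->]]].
rewrite -map_mask !size_map -/(letters _) => lt /ev_letters_eq Em.
by move: lt; rewrite ltnNge mina //; apply: etrans Em Ea.
Qed.

Lemma not_sortedP (T : Type) (e : rel T) (s : seq T) : ~~ sorted e s ->
  exists u i j v, s = u ++ [:: i, j & v] /\ ~~ e i j.
Proof.
case: s => // i s; elim: s i => //= j s IH i; rewrite negb_and.
case/orP=> [eij|/IH [u [k [l [v [-> ekl]]]]]].
  by exists [::], i, j, s.
by exists (i :: u), k, l, v.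
Qed.

(** Consecutive letters are distinct by reducedness; if they did not differ by 1, commuting them
    would give a second element of the class. *)
Lemma singleton_class_sorted n (s : 'S_n.+1) (a : (perm_length s).-tuple 'I_n) :
  a \in singleton_classes s -> sorted adjacent (letters a).
Proof.
rewrite inE => /andP[/letters_reduced ra /eqP class_a]; apply: contraT.
rewrite sorted_map => /not_sortedP [u [i [j [v [Ea nij]]]]].
have ij : val i <> val j.
  move=> /val_inj ij; move: ra; rewrite Ea /letters map_cat reduced_cat.
  rewrite ij /= => /andP[_ /and3P[lt + _]]; move: lt.
  have -> : swap (Posz j) (Posz j) = Posz j + 1 by unswap.
  have -> : swap (Posz j) (Posz j + 1) = Posz j by unswap.
  by move: (ev _ _) (ev _ _) => x y; lia.
have sz : size (u ++ [:: j, i & v]) == perm_length s.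
  by rewrite -(size_tuple a) Ea !size_cat.
have : Tuple sz \in commutation_class a.
  rewrite inE; apply: connect1; apply/commutationP; exists u, v, i, j.
  by split=> //; move: nij ij; rewrite /= /adjacent; lia.
rewrite class_a inE -val_eqE /= Ea eqseq_cat // eqxx /= eqseq_cons.
by case: eqP => // ji; case: ij; rewrite ji.
Qed.

Close Scope ring_scope.

Theorem theoremA (n : nat) (hn : 1 <= n) (s : 'S_n.+1) :
  #|singleton_classes s| <= 4.
Proof.
have [w0 Ew0] := word_perm_surj s.
pose f (a : (perm_length s).-tuple 'I_n) := letters a.
have f_inj : injective f.
  by move=> a b ab; apply: val_inj; apply: inj_map ab => i j [/val_inj].
rewrite cardE -(size_map f); apply: (words_bound (w := letters w0)).
  by rewrite (map_inj_uniq f_inj) enum_uniq.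
move=> _ /mapP[a + ->]; rewrite mem_enum => sa; split.
- exact: singleton_class_sorted sa.
- by apply: letters_reduced; move: sa; rewrite inE => /andP[].
apply/ev_letters_eq; rewrite Ew0; apply/eqP.
by move: sa; rewrite !inE => /andP[].
Qed.
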